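(* Let $\Gamma = (S,E)$ be a simple graph and $s_1 \in S$. Let $(G_s)_{s \in S}$ be a family of discrete groups and denote by $G$ their graph product given by $\Gamma$. Let $H < G_{s_1}$ be a subgroup of finite index $k$. Denote $[k] = \{1,\ldots,k\}$ and define the new simple graph $\Gamma' = (S',E')$ with $S' = (\operatorname{star} s_1) \sqcup ([k] \times (S \setminus \operatorname{star} s_1))$ and with the following edges. - For $s,t \in \operatorname{star} s_1$, we have $(s,t) \in E'$ iff $(s,t) \in E$. - For $s,t \in S \setminus \operatorname{star} s_1$ and $i,j \in [k]$, we have $((i,s),(j,t)) \in E'$ iff $i=j$ and $(s,t) \in E$. - For $s \in \operatorname{star} s_1$, $t \in S \setminus \operatorname{star} s_1$ and $i \in [k]$, we have $(s,(i,t)) \in E'$ iff $(s,t) \in E$ (and symmetrically). Define the discrete groups $G'_{s_1} = H$, $G'_s = G_s$ for all $s \in \operatorname{link} s_1$ and $G'_{(i,s)} = G_s$ for all $i \in [k]$ and $s \in S \setminus \operatorname{star} s_1$. Denote by $G'$ their graph product given by $\Gamma'$. Then $G'$ is isomorphic to an index $k$ subgroup of $G$. If the graph $\Gamma$ is rigid, also the graph $\Gamma'$ is rigid. More precisely, if $G_{s_1}/H = \{g_1 H,\ldots,g_k H\}$, there is a unique group homomorphism $\varphi : G' \to G$ satisfying $\varphi(g) = g$ for all $g \in G'_s$, $s \in \operatorname{star} s_1$, and $\varphi(g) = g_i^{-1} g g_i$ for all $g \in G'_{(i,s)}$, $i \in [k]$ and $s \in S \setminus \operatorname{star} s_1$.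 This homomorphism $\varphi$ is faithful and $[G:\varphi(G')] = k$.
   Context: A simple graph $\Gamma = (S,E)$ consists of a set $S$ and a subset $E \subset S \times S$ that is symmetric and contains no $(s,s)$. For $s \in S$, $\operatorname{link} s = \{t \in S \mid (s,t) \in E\}$ and $\operatorname{star} s = \{s\} \cup \operatorname{link} s$; for $U \subset S$, $\operatorname{link}(U) = \bigcap_{u \in U}\operatorname{link} u$ (equal to $S$ if $U = \emptyset$). The graph is rigid if $\operatorname{link}(\operatorname{link} s) = \{s\}$ for all $s \in S$. The graph product of groups $(G_s)_{s\in S}$ given by $\Gamma$ is the quotient of the free product of the $G_s$ by the relations that $G_s$ and $G_t$ commute whenever $(s,t) \in E$. *)

(* Defs.v *)
From HB Require Import structures.
From mathcomp Require Import all_boot.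
From mathcomp Require Import all_classical.

Set Implicit Arguments.
Unset Strict Implicit.
Unset Printing Implicit Defensive.

Local Open Scope classical_set_scope.
Local Open Scope group_scope.
Local Open Scope quotient_scope.

(* Over an arbitrary set: every type S is the choiceType {classic S}, and no
   finiteness is assumed. *)
Record simple_graph (S : choiceType) := SimpleGraph {
  edge : rel S;
  edge_sym : symmetric edge;
  edge_irr : irreflexive edge
}.

Section Graphs.
Variables (S : choiceType) (Gam : simple_graph S).

Definition link (s : S) : set S := [set t | edge Gam s t].

Definition star (s : S) : set S := s |` link s.

Definition link_set (U : set S) : set S := \bigcap_(u in U) link u.

Definition rigid : Prop := forall s, link_set (link s) = [set s].

End Graphs.

Section Index.
Variable G : groupType.

Definition left_coset (A : set G) (x : G) : set G := [set x * a | a in A].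

(* The set G / A of all x A. *)
Definition left_cosets (A : set G) : set (set G) := range (left_coset A).

Definition has_index (A : set G) (k : nat) : Prop :=
  (left_cosets A #= `I_k)%card.

End Index.

Section Subgroup.
Variables (G : groupType) (H : groupClosed G).

Definition subgroup := {x : G | x \in H}.

HB.instance Definition _ := SubChoice.on subgroup.

Fact subgroup_closed : group_closed [in H].
Proof. by split; [exact: gpred1 | exact: gpredF]. Qed.

HB.instance Definition _ :=
  SubChoice_isSubGroup.Build G _ subgroup subgroup_closed.

End Subgroup.

Section WordMonoid.
Variable T : choiceType.
Definition word := seq T.
HB.instance Definition _ := Choice.on word.
HB.instance Definition _ := isMonoid.Build word (@catA T) (@cat0s T) (@cats0 T).
End WordMonoid.

(* The quotient of M by the relations x = y, for all x and y such that R x y.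
   When M is a group, so is the quotient: it is M modulo the normal subgroup
   generated by the x^-1 * y. *)
Section Quotient.
Variables (M : monoidType) (R : M -> M -> Prop).

Inductive congruence : M -> M -> Prop :=
  | congr_gen x y : R x y -> congruence x y
  | congr_refl x : congruence x x
  | congr_sym x y : congruence x y -> congruence y x
  | congr_trans x y z : congruence x y -> congruence y z -> congruence x z
  | congr_mul x x' y y' :
      congruence x x' -> congruence y y' -> congruence (x * y) (x' * y').

Definition congruenceb : rel M := fun x y => `[< congruence x y >].

Fact congruenceb_refl : reflexive congruenceb.
Proof. by move=> x; apply/asboolP/congr_refl. Qed.

Fact congruenceb_sym : symmetric congruenceb.
Proof. by move=> x y; apply/asboolP/asboolP => /congr_sym. Qed.

Fact congruenceb_trans : transitive congruenceb.
Proof.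
by move=> y x z /asboolP xy /asboolP yz; apply/asboolP/(congr_trans xy yz).
Qed.

Canonical congruence_equiv :=
  EquivRel congruenceb congruenceb_refl congruenceb_sym congruenceb_trans.

Definition mquotient := {eq_quot congruence_equiv}.

HB.instance Definition _ := EqQuotient.on mquotient.
HB.instance Definition _ := Choice.on mquotient.

Lemma mquotientP (x y : M) :
  \pi_mquotient x = \pi_mquotient y <-> congruence x y.
Proof.
by split=> [/eqmodP/asboolP // | xy]; apply/eqmodP; apply/asboolP.
Qed.

Lemma congruence_repr (x : M) : congruence (repr (\pi_mquotient x)) x.
Proof. by apply/mquotientP; rewrite reprK. Qed.

Definition mquotient_one : mquotient := \pi_mquotient 1.
Definition mquotient_mul (a b : mquotient) : mquotient :=
  \pi_mquotient (repr a * repr b).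

Lemma mquotient_mulE (x y : M) :
  mquotient_mul (\pi x) (\pi y) = \pi_mquotient (x * y).
Proof. by apply/mquotientP/congr_mul; exact: congruence_repr. Qed.

Fact mquotient_mulA : associative mquotient_mul.
Proof.
elim/quotW=> x; elim/quotW=> y; elim/quotW=> z.
by rewrite !mquotient_mulE mulgA.
Qed.

Fact mquotient_mul1 : left_id mquotient_one mquotient_mul.
Proof. by elim/quotW=> x; rewrite mquotient_mulE mul1g. Qed.

Fact mquotient_mulr1 : right_id mquotient_one mquotient_mul.
Proof. by elim/quotW=> x; rewrite mquotient_mulE mulg1. Qed.

HB.instance Definition _ := isMonoid.Build mquotient
  mquotient_mulA mquotient_mul1 mquotient_mulr1.

End Quotient.

Section GroupQuotient.
Variables (G : groupType) (R : G -> G -> Prop).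

Lemma congruenceV (x y : G) : congruence R x y -> congruence R x^-1 y^-1.
Proof.
move=> xy; apply: congr_sym.
suff: congruence R (y^-1 * x * x^-1) (y^-1 * y * x^-1).
  by rewrite mulgK mulVg mul1g.
apply: congr_mul; last exact: congr_refl.
by apply: congr_mul; first exact: congr_refl.
Qed.

Definition gquotient_inv (a : mquotient R) : mquotient R := \pi_(mquotient R) (repr a)^-1.

Lemma gquotient_invE (x : G) : gquotient_inv (\pi x) = \pi_(mquotient R) x^-1.
Proof. exact/mquotientP/congruenceV/congruence_repr. Qed.

Fact gquotient_mulV : left_inverse 1 gquotient_inv (@mul (mquotient R)).
Proof. by elim/quotW=> x; rewrite gquotient_invE [LHS]mquotient_mulE mulVg. Qed.

Fact gquotient_mulrV : right_inverse 1 gquotient_inv (@mul (mquotient R)).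
Proof. by elim/quotW=> x; rewrite gquotient_invE [LHS]mquotient_mulE mulgV. Qed.

HB.instance Definition _ := hasInv.Build (mquotient R) gquotient_inv.
HB.instance Definition _ := Monoid_isGroup.Build (mquotient R)
  gquotient_mulV gquotient_mulrV.

End GroupQuotient.

(* The free product of the G s: words in the elements of the G s, modulo deletion
   of units and multiplication of adjacent letters from the same factor. *)
Section FreeProduct.
Variables (S : choiceType) (G : S -> groupType).

Definition letter (s : S) (x : G s) : word {s : S & G s} :=
  [:: existT (fun s => G s : Type) s x].

Inductive free_rel : word {s : S & G s} -> word {s : S & G s} -> Prop :=
  | free_rel1 s : free_rel (letter (1 : G s)) 1
  | free_relM s (x y : G s) : free_rel (letter x * letter y) (letter (x * y)).

Definition free_product := mquotient free_rel.

HB.instance Definition _ := Monoid.on free_product.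

Definition word_inv (w : word {s : S & G s}) : word {s : S & G s} :=
  rev (map (fun p => existT (fun s => G s : Type) (tag p) (tagged p)^-1) w).

Lemma word_invM (v w : word {s : S & G s}) :
  word_inv (v * w) = word_inv w * word_inv v.
Proof. by rewrite /word_inv map_cat rev_cat. Qed.

Lemma letterV s (x : G s) : word_inv (letter x) = letter x^-1.
Proof. by []. Qed.

Lemma congruence_word_inv v w :
  congruence free_rel v w -> congruence free_rel (word_inv v) (word_inv w).
Proof.
elim=> {v w} [_ _ [s|s x y]|x|x y _|x y z _ xy _|x x' y y' _ xx _ yy].
- by rewrite letterV invg1; apply/congr_gen/free_rel1.
- by rewrite word_invM !letterV invgM; apply/congr_gen/free_relM.
- exact: congr_refl.
- exact: congr_sym.
- exact: congr_trans.
- by rewrite !word_invM; exact: congr_mul.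
Qed.

Definition free_inv (a : free_product) : free_product := \pi_free_product (word_inv (repr a)).

Lemma free_invE w : free_inv (\pi w) = \pi_free_product (word_inv w).
Proof. exact/mquotientP/congruence_word_inv/congruence_repr. Qed.

Lemma word_mulV w : congruence free_rel (word_inv w * w) 1.
Proof.
elim: w => [|[s x] w IHw]; first exact: congr_refl.
rewrite -[_ :: w]/(letter x * w) word_invM letterV.
apply: (congr_trans _ IHw); rewrite -mulgA; apply: congr_mul.
  exact: congr_refl.
rewrite mulgA.
have {2}-> : w = (1 : word {s : S & G s}) * w by [].
apply: congr_mul; last exact: congr_refl.
apply: congr_trans (congr_gen (free_rel1 s)).
by rewrite -(mulVg x); apply/congr_gen/free_relM.
Qed.

Lemma word_invK : involutive word_inv.
Proof.
move=> w; rewrite /word_inv map_rev revK -map_comp map_id_in // => -[s x] _.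
by rewrite /= invgK.
Qed.

Fact free_mulV : left_inverse 1 free_inv (@mul free_product).
Proof.
elim/quotW=> w; rewrite free_invE [LHS]mquotient_mulE.
exact/mquotientP/word_mulV.
Qed.

Fact free_mulrV : right_inverse 1 free_inv (@mul free_product).
Proof.
elim/quotW=> w; rewrite free_invE [LHS]mquotient_mulE.
by apply/mquotientP; rewrite -{1}(word_invK w); exact: word_mulV.
Qed.

HB.instance Definition _ := hasInv.Build free_product free_inv.
HB.instance Definition _ := Monoid_isGroup.Build free_product
  free_mulV free_mulrV.

Definition free_incl (s : S) (x : G s) : free_product := \pi_free_product (letter x).

End FreeProduct.

Section GraphProduct.
Variables (S : choiceType) (Gam : simple_graph S) (G : S -> groupType).

Inductive commutation : free_product G -> free_product G -> Prop :=
  | commutation_edge s t (x : G s) (y : G t) : edge Gam s t ->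
      commutation (free_incl x * free_incl y) (free_incl y * free_incl x).

Definition graph_product := mquotient commutation.

HB.instance Definition _ := Group.on graph_product.

Definition gp_incl (s : S) (x : G s) : graph_product := \pi_graph_product (free_incl x).

End GraphProduct.

Section Blowup.
Variables (S : choiceType) (Gam : simple_graph S) (s1 : S) (k : nat).

Definition blowup_vertex : choiceType :=
  (star Gam s1 + 'I_k * ~` star Gam s1)%type.

Definition blowup_edge : rel blowup_vertex := fun x y =>
  match x, y with
  | inl s, inl t => edge Gam (val s) (val t)
  | inr (i, s), inr (j, t) => (i == j) && edge Gam (val s) (val t)
  | inl s, inr (_, t) => edge Gam (val s) (val t)
  | inr (_, t), inl s => edge Gam (val t) (val s)
  end.

Fact blowup_edge_sym : symmetric blowup_edge.
Proof.
by move=> [s|[i s]] [t|[j t]] /=; rewrite 1?eq_sym edge_sym.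
Qed.

Fact blowup_edge_irr : irreflexive blowup_edge.
Proof. by move=> [s|[i s]] /=; rewrite edge_irr ?andbF. Qed.

Definition blowup_graph := SimpleGraph blowup_edge_sym blowup_edge_irr.

Variables (G : S -> groupType) (H : groupClosed (G s1)).

(* H when s = s1, and G s otherwise; star_group_incl is the inclusion in G s, with
   a transport from G s1 to G s in the first case. *)
Definition star_group (s : S) : groupType :=
  match s =P s1 with
  | ReflectT _ => subgroup H
  | ReflectF _ => G s
  end.

Definition star_group_incl (s : S) : star_group s -> G s :=
  match s =P s1 as r return
    match r with
    | ReflectT _ => subgroup H : groupType
    | ReflectF _ => G s
    end -> G s
  with
  | ReflectT e => fun x => ecast t (G t) (esym e) (val x)
  | ReflectF _ => id
  end.

Definition blowup_group (v : blowup_vertex) : groupType :=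
  match v with
  | inl s => star_group (val s)
  | inr (_, t) => G (val t)
  end.

End Blowup.

(* Main.v *)
(* G acts on X = [k] x G' in the way it would act by left multiplication on
   itself if every element were written uniquely as g_i phi(w): for x in G_{s1}
   with x g_i = g_j h and h in H, x maps (i, w) to (j, h w); an element x of
   another vertex group maps (i, w) to (i, x' w), with x' the copy of x in G'_s or
   G'_{(i,s)}. The edges of Gamma' are precisely what makes the commutation
   relations of G hold. With i0 and h0 such that g_i0 = h0^-1, the point
   p_w = (i0, h0 w) stands for phi(w), and phi(v) maps p_w to p_{v w}, so phi is
   injective. The map (i, w) |-> g_i phi(w) is equivariant, so the
   g_i phi(G') are all the cosets, and they are distinct since g_i phi(w) maps
   p_1 to (i, w). *)
Require Import Defs.
From HB Require Import structures.
From mathcomp Require Import all_boot.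
From mathcomp Require Import all_classical.

Set Implicit Arguments.
Unset Strict Implicit.
Unset Printing Implicit Defensive.

Local Open Scope classical_set_scope.
Local Open Scope group_scope.
Local Open Scope quotient_scope.

(** * Finite families and cardinality *)

Section OrdinalFamilies.
Variables (T : Type) (k : nat).
Implicit Types (X : set T) (f : 'I_k -> T).

Lemma card_range_ord f : injective f -> (range f #= `I_k)%card.
Proof.
move=> f_inj; apply: card_eq_trans (card_esym card_II).
by apply: inj_card_eq => x y _ _; exact: f_inj.
Qed.

Lemma card_eq_ord_range X :
  (X #= `I_k)%card -> exists2 f : 'I_k -> T, injective f & range f = X.
Proof.
move=> /card_set_bijP[c [c_fun c_inj c_surj]].
have /choice[f fP] : forall i : 'I_k, exists x, X x /\ c x = i.
  by move=> i; have [x Xx cx] := c_surj i (ltn_ord i); exists x.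
exists f => [i j fij|]; first by apply/ord_inj; rewrite -(fP i).2 fij (fP j).2.
apply/seteqP; split=> [_ [i _ <-]|x Xx]; first exact: (fP i).1.
exists (Ordinal (c_fun x Xx)) => //.
by apply: c_inj; rewrite ?inE ?(fP _).2 //; exact: (fP _).1.
Qed.

(** Pigeonhole: choosing preimages under [f] of a bijective enumeration [b] of its range gives an
    injective self-map [r] of ['I_k]. It is a permutation, and [f] is [b] composed with its
    inverse. *)
Lemma card_range_ord_inj f : (range f #= `I_k)%card -> injective f.
Proof.
move=> /card_eq_ord_range[b b_inj brange].
have /choice[r rP] : forall i, exists j, f j = b i.
  move=> i; have : range b (b i) by exists i.
  by rewrite brange => -[j _ fj]; exists j.
have r_inj : injective r by move=> i j rij; apply: b_inj; rewrite -!rP rij.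
have [s _ sK] := injF_bij r_inj.
by move=> i j; rewrite -(sK i) -(sK j) !rP => /b_inj ->.
Qed.

End OrdinalFamilies.

(** * Left cosets, and the index from representatives *)

Section LeftCosets.
Variables (G : groupType) (H : groupClosed G).

Lemma left_coset_eqP (x y : G) :
  left_coset [set` H] x = left_coset [set` H] y <-> x^-1 * y \in H.
Proof.
split=> [xy|xyH].
  have : left_coset [set` H] y y by exists 1; rewrite ?mulg1 //=; exact: gpred1.
  by rewrite -xy => -[h hH <-]; rewrite mulKg.
apply/seteqP; split=> _ [h /= hH <-].
  exists ((x^-1 * y)^-1 * h); first by rewrite /= gpredM ?gpredV.
  by rewrite invgM invgK -mulgA mulVKg.
exists (x^-1 * y * h); first by rewrite /= gpredM.
by rewrite -mulgA mulVKg.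
Qed.

Lemma has_index_reps k (g : 'I_k -> G) :
    (forall i j, (g i)^-1 * g j \in H -> i = j) ->
    (forall x, exists i, (g i)^-1 * x \in H) ->
  has_index [set` H] k.
Proof.
move=> g_inj g_surj; rewrite /has_index.
have -> : left_cosets [set` H] = range (fun i => left_coset [set` H] (g i)).
  apply/seteqP; split=> _ [x _ <-]; last by exists (g x).
  by have [i /left_coset_eqP gi] := g_surj x; exists i.
by apply: card_range_ord => i j /left_coset_eqP; exact: g_inj.
Qed.

End LeftCosets.

(** * Maps out of a quotient monoid *)

Section MonoidQuotientLift.
Variables (M N : monoidType) (R : M -> M -> Prop) (f : M -> N).
Hypothesis f_morph : monoid_morphism f.
Hypothesis f_rel : forall x y, R x y -> f x = f y.

Definition mquotient_lift (a : mquotient R) : N := f (repr a).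

Lemma congruence_lift x y : congruence R x y -> f x = f y.
Proof.
elim=> {x y} [x y /f_rel|x|x y _ ->|x y z _ -> _ ->|x x' y y' _ xx' _ yy'] //.
by rewrite !f_morph.2 xx' yy'.
Qed.

Lemma mquotient_liftE x : mquotient_lift (\pi x) = f x.
Proof. exact/congruence_lift/congruence_repr. Qed.

Lemma mquotient_lift_morph : monoid_morphism mquotient_lift.
Proof.
split; first by rewrite [LHS]mquotient_liftE f_morph.1.
elim/quotW=> x; elim/quotW=> y.
by rewrite [_ * _]mquotient_mulE !mquotient_liftE f_morph.2.
Qed.

End MonoidQuotientLift.

(** * The image of a group morphism as a subgroup *)

Section MorphismRange.
Variables (G K : groupType) (f : G -> K).
Hypothesis f_morph : monoid_morphism f.

Definition morphism_range : {pred K} := fun y => `[< range f y >].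

Lemma morphV x : f x^-1 = (f x)^-1.
Proof. by apply: (mulgI (f x)); rewrite -f_morph.2 !mulgV f_morph.1. Qed.

Lemma morphism_rangeP y : reflect (exists x, f x = y) (y \in morphism_range).
Proof. by apply: (iffP (asboolP _)) => [[x _ <-]|[x <-]]; exists x. Qed.

Fact morphism_range1 : 1 \in morphism_range.
Proof. by apply/morphism_rangeP; exists 1; exact: f_morph.1. Qed.

Fact morphism_rangeM :
  {in morphism_range &, forall x y, x * y \in morphism_range}.
Proof.
move=> _ _ /morphism_rangeP[x <-] /morphism_rangeP[y <-].
by apply/morphism_rangeP; exists (x * y); exact: f_morph.2.
Qed.

Fact morphism_rangeV : {in morphism_range, forall x, x^-1 \in morphism_range}.
Proof.
move=> _ /morphism_rangeP[x <-].
by apply/morphism_rangeP; exists x^-1; exact: morphV.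
Qed.

Definition morphism_image : groupClosed K :=
  HB.pack_for (groupClosed K) morphism_range
    (isMul1Closed.Build K morphism_range morphism_range1)
    (isMulClosed.Build K morphism_range morphism_rangeM)
    (isInvClosed.Build K morphism_range morphism_rangeV).

Lemma morphism_image_set : [set` morphism_image] = range f.
Proof.
apply/seteqP; split=> x /=; first by move=> /morphism_rangeP[y <-]; exists y.
by move=> [y _ <-]; apply/morphism_rangeP; exists y.
Qed.

Lemma mem_morphism_range x : f x \in morphism_image.
Proof. by apply/morphism_rangeP; exists x. Qed.

Definition morphism_corestr (x : G) : subgroup morphism_image :=
  Sub (f x) (mem_morphism_range x).

Lemma morphism_corestr_morph : monoid_morphism morphism_corestr.
Proof.
by split=> [|x y]; apply/val_inj; rewrite /= ?f_morph.1 ?f_morph.2.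
Qed.

Lemma morphism_corestr_bij : injective f -> bijective morphism_corestr.
Proof.
move=> f_inj.
have surj y : exists x, morphism_corestr x = y.
  have /morphism_rangeP[x fx] := valP y.
  by exists x; apply/val_inj.
have [h hK] := choice surj.
exists h => // x; apply: f_inj.
exact: (congr1 val (hK (morphism_corestr x))).
Qed.

End MorphismRange.

(** * Generation and universal property of graph products *)

Section GraphProductTheory.
Variables (S : choiceType) (Gam : simple_graph S) (G : S -> groupType).
Local Notation GP := (graph_product Gam G).

Lemma gp_incl1 s : gp_incl Gam (1 : G s) = 1.
Proof.
congr (\pi_(mquotient _) _).
exact/mquotientP/congr_gen/free_rel1.
Qed.

Lemma gp_inclM s (x y : G s) :
  gp_incl Gam (x * y) = gp_incl Gam x * gp_incl Gam y.
Proof.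
rewrite [RHS]mquotient_mulE; congr (\pi_(mquotient _) _).
by rewrite [RHS]mquotient_mulE; apply/esym/mquotientP/congr_gen/free_relM.
Qed.

Lemma gp_inclV s (x : G s) : gp_incl Gam x^-1 = (gp_incl Gam x)^-1.
Proof.
by apply: (mulgI (gp_incl Gam x)); rewrite -gp_inclM !mulgV gp_incl1.
Qed.

Lemma gp_inclC s t (x : G s) (y : G t) :
  edge Gam s t -> commute (gp_incl Gam x) (gp_incl Gam y).
Proof.
move=> st; rewrite /commute [LHS]mquotient_mulE [RHS]mquotient_mulE.
exact/mquotientP/congr_gen/commutation_edge.
Qed.

(** An element is a class of classes of words: both quotients are peeled off, and the induction runs
    over a word. *)
Lemma graph_product_ind (P : GP -> Prop) :
    P 1 -> (forall s (x : G s) a, P a -> P (gp_incl Gam x * a)) ->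
  forall a, P a.
Proof.
move=> P1 PM; elim/quotW; elim/quotW; elim=> [|[s x] w IHw] //.
have := PM s x _ IHw.
by rewrite [_ * _]mquotient_mulE [_ * _]mquotient_mulE.
Qed.

Lemma graph_product_morph_eq (N : monoidType) (phi psi : GP -> N) :
    monoid_morphism phi -> monoid_morphism psi ->
    (forall s (x : G s), phi (gp_incl Gam x) = psi (gp_incl Gam x)) ->
  phi = psi.
Proof.
move=> phi_morph psi_morph phipsi; apply/funext.
apply: graph_product_ind => [|s x a IHa].
  by rewrite phi_morph.1 psi_morph.1.
by rewrite phi_morph.2 psi_morph.2 phipsi IHa.
Qed.

Section Lift.
Variables (N : monoidType) (f : forall s, G s -> N).
Hypothesis f_morph : forall s, monoid_morphism (@f s).
Hypothesis f_comm : forall s t (x : G s) (y : G t),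
  edge Gam s t -> commute (f x) (f y).

Definition word_lift (w : word {s : S & G s}) : N :=
  \prod_(p <- w) f (tagged p).

Lemma word_lift_letter s (x : G s) : word_lift (letter x) = f x.
Proof. by rewrite /word_lift big_seq1. Qed.

Lemma word_lift_morph : monoid_morphism word_lift.
Proof.
split; first by rewrite /word_lift big_nil.
by move=> v w; rewrite /word_lift big_cat.
Qed.

Lemma word_lift_free_rel v w : free_rel v w -> word_lift v = word_lift w.
Proof.
case=> [s|s x y].
  by rewrite word_lift_letter (f_morph s).1 word_lift_morph.1.
by rewrite word_lift_morph.2 !word_lift_letter (f_morph s).2.
Qed.

Definition free_lift : free_product G -> N :=
  @mquotient_lift _ _ (@free_rel S G) word_lift.

Lemma free_lift_incl s (x : G s) : free_lift (free_incl x) = f x.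
Proof.
rewrite [LHS](mquotient_liftE word_lift_morph word_lift_free_rel).
exact: word_lift_letter.
Qed.

Lemma free_lift_morph : monoid_morphism free_lift.
Proof. exact: mquotient_lift_morph word_lift_morph word_lift_free_rel. Qed.

Lemma free_lift_commutation a b :
  @commutation S Gam G a b -> free_lift a = free_lift b.
Proof.
case=> s t x y st.
by rewrite !free_lift_morph.2 !free_lift_incl; exact: f_comm.
Qed.

(** The target [N] is only a monoid, so an action on a set can be a lift to [endo], with no prior
    proof that letters act by permutations. *)
Definition graph_product_lift : GP -> N :=
  @mquotient_lift _ _ (@commutation S Gam G) free_lift.

Lemma graph_product_lift_incl s (x : G s) :
  graph_product_lift (gp_incl Gam x) = f x.
Proof.
rewrite [LHS](mquotient_liftE free_lift_morph free_lift_commutation).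
exact: free_lift_incl.
Qed.

Lemma graph_product_lift_morph : monoid_morphism graph_product_lift.
Proof. exact: mquotient_lift_morph free_lift_morph free_lift_commutation. Qed.

End Lift.
End GraphProductTheory.

(** * Rigidity of the blown-up graph *)

Section Rigid.
Variables (S : choiceType) (Gam : simple_graph S) (s1 : S) (k : nat).

Lemma mem_starP (s : S) : reflect (s = s1 \/ edge Gam s1 s) (s \in star Gam s1).
Proof. by apply: (iffP idP); rewrite inE. Qed.

Lemma mem_starC (s : S) : s \in ~` star Gam s1 <-> s != s1 /\ ~~ edge Gam s1 s.
Proof.
rewrite inE; split=> [/not_orP[/= /eqP ? /negP ?] //|[ss1 ss1E]].
by move=> [/= /eqP|/=]; apply/negP.
Qed.

Lemma in_star1 : s1 \in star Gam s1.
Proof. by apply/mem_starP; left. Qed.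

(** Let [s] and [t] be the vertices of [Gam] under [v] and [w]. Lifting neighbours of [s] to
    neighbours of [v] transfers the double link condition to [Gam], where rigidity applies. Vertices
    of different kinds or in different copies lead to contradictions. *)
Lemma rigid_blowup : 0 < k -> rigid Gam -> rigid (blowup_graph Gam s1 k).
Proof.
(* When [v] lies in the star, its neighbours outside the star are tested through the copy [i0]. *)
move=> k_gt0 rig; pose i0 := Ordinal k_gt0.
have eq_of s t : (forall u, edge Gam s u -> edge Gam u t) -> t = s.
  move=> st; have : link_set Gam (link Gam s) t by move=> u /st.
  by rewrite rig.
have inC s : ~~ (s \in star Gam s1) -> s \in ~` star Gam s1 by rewrite in_setC.
pose v1 : blowup_vertex Gam s1 k := inl (exist _ s1 in_star1).
move=> v; apply/seteqP; split=> [w vw|_ -> u]; last first.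
  move=> vu; rewrite -[link _ _ _]/(is_true (edge _ u v)) edge_sym; exact: vu.
have {}vw u : edge (blowup_graph Gam s1 k) v u ->
    edge (blowup_graph Gam s1 k) u w by exact: vw.
rewrite /set1 /=.
case: v w vw => [[s sS]|[i [s sS]]] [[t tS]|[j [t tS]]] vw.
- congr inl; apply/val_inj; apply: eq_of => u su.
  have [uS|/inC uS] := boolP (u \in star Gam s1).
    exact: (vw (inl (exist _ u uS))).
  exact: (vw (inr (i0, exist _ u uS))) su.
- exfalso; have /mem_starC[ts1 ts1E] := tS.
  (* If [s] is in the link of [s1], then [v1] is a neighbour of [v], which would make [s1] adjacent
     to [t]. If [s = s1], all neighbours of [s] lie in the star, and rigidity forces [t = s1]. *)
  have /mem_starP[s_eq|s1s] := sS; last first.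
    by move: ts1E; have /= -> // := vw v1; rewrite edge_sym.
  move: ts1; have -> // : t = s1; last by rewrite eqxx.
  apply: eq_of => u s1u.
  have uS : u \in star Gam s1 by apply/mem_starP; right.
  by apply: (vw (inl (exist _ u uS))); rewrite /= s_eq.
- exfalso; move: (sS); rewrite in_setC; have <- : t = s; last by rewrite tS.
  apply: eq_of => u su.
  have [uS|/inC uS] := boolP (u \in star Gam s1).
    exact: (vw (inl (exist _ u uS))).
  by have := vw (inr (i, exist _ u uS)); rewrite /= eqxx; apply.
- have vw_in u (uS : u \in star Gam s1) : edge Gam s u -> edge Gam u t.
    exact: (vw (inl (exist _ u uS))).
  have vw_out u (uS : u \in ~` star Gam s1) : edge Gam s u ->
      (i == j) && edge Gam u t.
    by move=> su; have := vw (inr (i, exist _ u uS)); rewrite /= eqxx; apply.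
  have [ij|ij] := eqVneq i j.
    subst j; congr (inr (_, _)); apply/val_inj; apply: eq_of => u su.
    have [uS|/inC uS] := boolP (u \in star Gam s1); first exact: vw_in.
    by case/andP: (vw_out u uS su).
  (* A neighbour of [s] outside the star would give [i = j]. Hence all neighbours of [s] lie in the
     link of [s1], and rigidity gives [s1 = s]. *)
  exfalso; have /mem_starC[ss1 ss1E] := sS.
  move: (ss1); rewrite eq_sym; have -> // : s1 = s; last by rewrite eqxx.
  apply: eq_of => u su; rewrite edge_sym.
  have [|/inC uS] := boolP (u \in star Gam s1).
    by case/mem_starP=> // us1; rewrite edge_sym -us1 su in ss1E.
  by have := vw_out u uS su; rewrite (negPf ij).
Qed.

End Rigid.

(** * The vertex groups over the star, with [H] at [s1] *)

Section StarGroup.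
Variables (S : choiceType) (s1 : S).
Variables (G : S -> groupType) (H : groupClosed (G s1)).

(* A left inverse of star_group_incl, with junk value 1 on the elements of
   G s1 outside H. *)
Definition star_group_lift (s : S) : G s -> star_group H s :=
  match s =P s1 as r return
    G s -> match r with
    | ReflectT _ => subgroup H : groupType
    | ReflectF _ => G s
    end
  with
  | ReflectT e => fun x => insubd (1 : subgroup H) (ecast t (G t) e x)
  | ReflectF _ => id
  end.

Lemma star_group_inclK s :
  cancel (@star_group_incl S s1 G H s) (@star_group_lift s).
Proof.
rewrite /star_group_incl /star_group_lift /star_group.
by case: eqP => // e x; subst s; rewrite /= valKd.
Qed.

Lemma star_group_incl_morph s : monoid_morphism (@star_group_incl S s1 G H s).
Proof.
rewrite /star_group_incl /star_group.
by case: eqP => // e; subst s.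
Qed.

Lemma star_group_liftK s (x : G s) :
  s != s1 -> star_group_incl (star_group_lift x) = x.
Proof.
by rewrite /star_group_incl /star_group_lift /star_group; case: eqP.
Qed.

Lemma star_group_liftKH (x : G s1) :
  x \in H -> star_group_incl (star_group_lift x) = x.
Proof.
rewrite /star_group_incl /star_group_lift /star_group; case: eqP => // e xH.
by rewrite (eq_axiomK e) /= insubdK.
Qed.

Lemma star_group_incl_mem (x : star_group H s1) : star_group_incl x \in H.
Proof.
move: x; rewrite /star_group_incl /star_group; case: eqP => // e x.
by rewrite (eq_axiomK e) /=; exact: valP.
Qed.

End StarGroup.

(** The product is composition, so a monoid morphism into [endo X] is a left action on [X]. *)
Definition endo (X : Type) := X -> X.
HB.instance Definition _ (X : Type) := gen_eqMixin (endo X).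
HB.instance Definition _ (X : Type) := gen_choiceMixin (endo X).
HB.instance Definition _ (X : Type) := isMonoid.Build (endo X)
  (fun f g h => erefl : f \o (g \o h) = (f \o g) \o h)
  (fun f => erefl : id \o f = f) (fun f => erefl : f \o id = f).

(** * The homomorphism from the new graph product to the old one *)

Section CosetAction.
Variables (S : choiceType) (Gam : simple_graph S) (s1 : S).
Variables (G : S -> groupType) (H : groupClosed (G s1)) (k : nat).
Variable g : 'I_k -> G s1.
Hypothesis g_inj : forall i j, (g i)^-1 * g j \in H -> i = j.
Hypothesis g_surj : forall x, exists i, (g i)^-1 * x \in H.

Local Notation Gam' := (blowup_graph Gam s1 k).
Local Notation G' := (blowup_group H : blowup_vertex Gam s1 k -> groupType).
Local Notation GP := (graph_product Gam G).
Local Notation GP' := (graph_product Gam' G').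
Local Notation incl := (gp_incl Gam).

Definition blowup_hom_on (v : blowup_vertex Gam s1 k) : G' v -> GP :=
  match v with
  | inl s => fun x => incl (star_group_incl x)
  | inr (i, s) => fun x => (incl (g i))^-1 * incl x * incl (g i)
  end.

Lemma blowup_hom_on_morph v : monoid_morphism (@blowup_hom_on v).
Proof.
case: v => [s|[i s]] /=; split=> [|x y].
- by rewrite (star_group_incl_morph H (val s)).1 gp_incl1.
- by rewrite (star_group_incl_morph H (val s)).2 gp_inclM.
- by rewrite gp_incl1 mulg1 mulVg.
- by rewrite gp_inclM !mulgA mulgK.
Qed.

(** All neighbours of [s1] lie in its star, so a star vertex with a neighbour outside is in the
    link. Its group therefore commutes with every [g i]. *)
Lemma edge_star_out (s t : S) :
  edge Gam s t -> s \in star Gam s1 -> t \in ~` star Gam s1 -> edge Gam s s1.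
Proof.
move=> st /mem_starP[s_eq|]; last by rewrite edge_sym.
by move=> /mem_starC[_ /negP[]]; rewrite -s_eq.
Qed.

Lemma commute_conj (K : groupType) (x y z : K) :
  commute x y -> commute x z -> commute x (z^-1 * y * z).
Proof.
move=> xy xz; apply: commuteM => //; apply: commuteM => //; exact: commuteV.
Qed.

(** On an edge between the star and copy [i], the star element also commutes with [g i], hence with
    the conjugate. Adjacent outer vertices share the same [i], so both elements are conjugated by
    the same [g i]. *)
Lemma blowup_hom_on_comm v w (x : G' v) (y : G' w) :
  edge Gam' v w -> commute (blowup_hom_on x) (blowup_hom_on y).
Proof.
case: v w x y => [s|[i s]] [t|[j t]] x y.
- move=> st; apply: (gp_inclC (star_group_incl x) (star_group_incl y)).
  exact: st.
- move=> /= st; apply: commute_conj; apply: gp_inclC => //.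
  exact: (edge_star_out st (svalP s) (svalP t)).
- move=> /=; rewrite edge_sym => ts.
  apply/commute_sym/commute_conj; apply: gp_inclC => //.
  exact: (edge_star_out ts (svalP t) (svalP s)).
- move=> /andP[/eqP <- st]; rewrite /commute /= !mulgA !mulgK.
  by congr (_ * _); rewrite -!mulgA (@gp_inclC _ _ G _ _ x y st).
Qed.

Definition blowup_hom : GP' -> GP := graph_product_lift blowup_hom_on.

Lemma blowup_hom_morph : monoid_morphism blowup_hom.
Proof.
exact: graph_product_lift_morph blowup_hom_on_morph blowup_hom_on_comm.
Qed.

Lemma blowup_hom_incl v (x : G' v) :
  blowup_hom (gp_incl Gam' x) = blowup_hom_on x.
Proof.
exact: graph_product_lift_incl blowup_hom_on_morph blowup_hom_on_comm _ _.
Qed.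

(** * Copies of the old vertex groups in the new graph product *)

Definition base_vertex : star Gam s1 := exist _ s1 (in_star1 Gam s1).

(** The copy of [H], extended by the value 1 to all of [G s1] so that no membership proof has to be
    carried along. *)
Definition base_incl (h : G s1) : GP' :=
  gp_incl Gam' (star_group_lift H h : G' (inl base_vertex)).

Lemma base_incl1 : base_incl 1 = 1.
Proof.
rewrite /base_incl -(gp_incl1 Gam' G' (inl base_vertex)); congr gp_incl.
apply: (can_inj (@star_group_inclK _ _ _ H _)).
by rewrite star_group_liftKH ?gpred1 // (star_group_incl_morph H s1).1.
Qed.

Lemma base_inclM : {in H &, {morph base_incl : x y / x * y}}.
Proof.
move=> x y xH yH; rewrite /base_incl -gp_inclM; congr gp_incl.
apply: (can_inj (@star_group_inclK _ _ _ H _)).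
by rewrite (star_group_incl_morph H s1).2 !star_group_liftKH ?gpredM.
Qed.

Lemma blowup_hom_base h : h \in H -> blowup_hom (base_incl h) = incl h.
Proof.
by move=> hH; rewrite blowup_hom_incl /= star_group_liftKH.
Qed.

Lemma mem_starN s : ~ (s \in star Gam s1) -> s \in ~` star Gam s1.
Proof. by rewrite in_setC => /negP. Qed.

(** The copy of [x] that acts on level [i]. At [s1] it would send elements outside [H] to 1, whence
    the hypothesis [s != s1] in [blowup_incl_morph]. *)
Definition blowup_incl (i : 'I_k) (s : S) (x : G s) : GP' :=
  match pselect (s \in star Gam s1) with
  | left sS =>
      gp_incl Gam' (star_group_lift H x : G' (inl (exist _ s sS)))
  | right sS =>
      gp_incl Gam'
        (x : G' (inr (i, exist _ s (mem_starN sS))))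
  end.

Lemma blowup_incl_star i (s : star Gam s1) (x : G (val s)) :
  blowup_incl i x = gp_incl Gam' (star_group_lift H x : G' (inl s)).
Proof.
case: s x => s sS x; rewrite /blowup_incl; case: pselect => sS'; last first.
  by exfalso; exact: sS'.
by rewrite (bool_irrelevance sS sS').
Qed.

Lemma blowup_incl_out i (s : ~` star Gam s1) (x : G (val s)) :
  blowup_incl i x = gp_incl Gam' (x : G' (inr (i, s))).
Proof.
case: s x => s sS x; rewrite /blowup_incl; case: pselect => sS'.
  by exfalso; move: (sS); rewrite in_setC sS'.
by rewrite (bool_irrelevance sS (mem_starN sS')).
Qed.

Lemma blowup_incl_morph i s : s != s1 -> monoid_morphism (@blowup_incl i s).
Proof.
move=> ss1; rewrite /blowup_incl; case: pselect => sS; split=> [|x y].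
- rewrite -(gp_incl1 Gam' G' (inl (exist _ s sS))); congr gp_incl.
  apply: (can_inj (@star_group_inclK _ _ _ H _)).
  by rewrite star_group_liftK // (star_group_incl_morph H s).1.
- rewrite -gp_inclM; congr gp_incl.
  apply: (can_inj (@star_group_inclK _ _ _ H _)).
  by rewrite (star_group_incl_morph H s).2 !star_group_liftK.
- exact: gp_incl1.
- exact: gp_inclM.
Qed.

Lemma blowup_incl_comm i s t (x : G s) (y : G t) :
  edge Gam s t -> commute (blowup_incl i x) (blowup_incl i y).
Proof.
move=> st; rewrite /blowup_incl.
by case: pselect => sS; case: pselect => tS; apply: gp_inclC;
  rewrite /= ?eqxx // edge_sym.
Qed.

Lemma base_incl_comm i t (h : G s1) (y : G t) :
  edge Gam s1 t -> commute (base_incl h) (blowup_incl i y).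
Proof.
move=> s1t; have tS : t \in star Gam s1 by apply/mem_starP; right.
rewrite (@blowup_incl_star i (exist _ t tS)); exact: gp_inclC.
Qed.

(** Link vertices are not duplicated. This makes their action compatible with [base_act], which
    changes the level. *)
Lemma blowup_incl_link i j s (x : G s) :
  edge Gam s1 s -> blowup_incl i x = blowup_incl j x.
Proof.
move=> s1s; have sS : s \in star Gam s1 by apply/mem_starP; right.
by rewrite !(@blowup_incl_star _ (exist _ s sS)).
Qed.

(** This is the equivariance of [coset_eval] for letters away from [s1]: link groups commute with
    [g i], and for outer vertices the conjugation cancels. *)
Lemma blowup_hom_blowup_incl i s (x : G s) : s != s1 ->
  incl (g i) * blowup_hom (blowup_incl i x) = incl x * incl (g i).
Proof.
move=> ss1; rewrite /blowup_incl; case: pselect => sS;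
  rewrite blowup_hom_incl /=.
  rewrite star_group_liftK //; apply: gp_inclC.
  by case/mem_starP: sS ss1 => [->|//]; rewrite eqxx.
by rewrite !mulgA mulgV mul1g.
Qed.

(** * The action of the old graph product on [coset_space] *)

Definition coset_index (x : G s1) : 'I_k := projT1 (cid (g_surj x)).

Lemma coset_indexP x : (g (coset_index x))^-1 * x \in H.
Proof. exact: projT2 (cid (g_surj x)). Qed.

Lemma coset_index_eq i x : (g i)^-1 * x \in H -> coset_index x = i.
Proof.
move=> gixH; apply/esym/g_inj.
have -> : (g i)^-1 * g (coset_index x)
    = (g i)^-1 * x * ((g (coset_index x))^-1 * x)^-1.
  by rewrite invgM invgK -!mulgA mulVKg.
by rewrite gpredM ?gpredV ?coset_indexP.
Qed.

Definition coset_space := ('I_k * GP')%type.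

Definition base_act (x : G s1) (p : coset_space) : coset_space :=
  let y := x * g p.1 in
  (coset_index y, base_incl ((g (coset_index y))^-1 * y) * p.2).

Definition coset_act_on (s : S) (x : G s) : endo coset_space :=
  match s =P s1 with
  | ReflectT e => base_act (ecast t (G t) e x)
  | ReflectF _ => fun p => (p.1, blowup_incl p.1 x * p.2)
  end.

Lemma coset_act_on_base (x : G s1) : coset_act_on x = base_act x.
Proof. by rewrite /coset_act_on; case: eqP => // e; rewrite (eq_axiomK e). Qed.

Lemma coset_act_onE s (x : G s) : s != s1 ->
  coset_act_on x = fun p => (p.1, blowup_incl p.1 x * p.2).
Proof. by rewrite /coset_act_on; case: eqP. Qed.

(** By [g_inj] the factorization of [x * g i] is unique, so later computations exhibit one instead
    of evaluating [coset_index]. *)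
Lemma base_actE x i j h w :
  h \in H -> x * g i = g j * h -> base_act x (i, w) = (j, base_incl h * w).
Proof.
move=> hH xg; have jE : coset_index (x * g i) = j.
  by apply: coset_index_eq; rewrite xg mulKg.
by rewrite /base_act /= jE xg mulKg.
Qed.

Lemma base_act_decomp x i : exists j h, h \in H /\ x * g i = g j * h.
Proof.
exists (coset_index (x * g i)), ((g (coset_index (x * g i)))^-1 * (x * g i)).
by rewrite mulVKg; split=> //; exact: coset_indexP.
Qed.

(** At [s1] this is a cocycle identity: [y * g i = g j * h] and [x * g j = g l * h'] give
    [x * y * g i = g l * (h' * h)]. *)
Lemma coset_act_on_morph s : monoid_morphism (@coset_act_on s).
Proof.
have [-> {s}|ss1] := eqVneq s s1.
  split=> [|x y]; apply/funext => -[i w]; rewrite ?coset_act_on_base.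
    rewrite (@base_actE _ _ i 1) ?gpred1 ?mul1g ?mulg1 //.
    by rewrite base_incl1 mul1g.
  have [j [h [hH yg]]] := base_act_decomp y i.
  have [l [h' [h'H xg]]] := base_act_decomp x j.
  rewrite /mul /= (base_actE _ hH yg) (base_actE _ h'H xg).
  rewrite (@base_actE _ _ l (h' * h)) ?gpredM //.
    by rewrite base_inclM // mulgA.
  by rewrite -mulgA yg mulgA xg mulgA.
split=> [|x y]; apply/funext => -[i w]; rewrite !coset_act_onE //=.
  by rewrite (blowup_incl_morph i ss1).1 mul1g.
rewrite -[RHS]/(i, blowup_incl i x * (blowup_incl i y * w)).
by rewrite (blowup_incl_morph i ss1).2 mulgA.
Qed.

(** Here [x] changes the level and multiplies by an element of [H], while [y] has one copy for all
    levels, which commutes with the copy of [H]. *)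
Lemma coset_act_on_base_comm t (x : G s1) (y : G t) :
  edge Gam s1 t -> commute (coset_act_on x) (coset_act_on y).
Proof.
move=> s1t; have ts1 : t != s1 by apply: contraTneq s1t => ->; rewrite edge_irr.
apply/funext => -[i w]; have [j [h [hH xg]]] := base_act_decomp x i.
rewrite coset_act_on_base coset_act_onE //.
rewrite -[LHS]/(base_act x (i, blowup_incl i y * w)).
rewrite -[RHS]/(let p := base_act x (i, w) in (p.1, blowup_incl p.1 y * p.2)).
rewrite !(base_actE _ hH xg) /= !mulgA (blowup_incl_link i j) //.
by rewrite (base_incl_comm j h y s1t).
Qed.

Lemma coset_act_on_comm s t (x : G s) (y : G t) :
  edge Gam s t -> commute (coset_act_on x) (coset_act_on y).
Proof.
have [s_eq|ss1] := eqVneq s s1; first by subst s; exact: coset_act_on_base_comm.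
have [t_eq|ts1] := eqVneq t s1.
  by subst t; rewrite edge_sym => ?; apply/commute_sym/coset_act_on_base_comm.
move=> st; apply/funext => -[i w]; rewrite !coset_act_onE //.
rewrite -[LHS]/(i, blowup_incl i x * (blowup_incl i y * w)).
rewrite -[RHS]/(i, blowup_incl i y * (blowup_incl i x * w)).
by rewrite !mulgA (blowup_incl_comm i x y st).
Qed.

Definition coset_act : GP -> endo coset_space :=
  graph_product_lift coset_act_on.

Lemma coset_act_morph : monoid_morphism coset_act.
Proof.
exact: graph_product_lift_morph coset_act_on_morph coset_act_on_comm.
Qed.

Lemma coset_act_incl s (x : G s) : coset_act (incl x) = coset_act_on x.
Proof.
exact: graph_product_lift_incl coset_act_on_morph coset_act_on_comm _ _.
Qed.

Lemma coset_act1 p : coset_act 1 p = p.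
Proof. by rewrite coset_act_morph.1. Qed.

Lemma coset_actM a b p : coset_act (a * b) p = coset_act a (coset_act b p).
Proof. by rewrite coset_act_morph.2. Qed.

(** * Equivariance, injectivity and index *)

Definition coset_eval (p : coset_space) : GP := incl (g p.1) * blowup_hom p.2.

Lemma coset_eval_act a p : coset_eval (coset_act a p) = a * coset_eval p.
Proof.
move: a p; apply: graph_product_ind => [|s x a IHa] p.
  by rewrite coset_act1 mul1g.
rewrite coset_actM coset_act_incl -mulgA -IHa.
case: (coset_act a p) => i w {p IHa}; rewrite /coset_eval /=.
have [s_eq|ss1] := eqVneq s s1.
  subst s; rewrite coset_act_on_base.
  have [j [h [hH xg]]] := base_act_decomp x i.
  rewrite (base_actE _ hH xg) /= blowup_hom_morph.2 blowup_hom_base //.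
  by rewrite !mulgA -!gp_inclM xg.
rewrite coset_act_onE //= blowup_hom_morph.2 mulgA blowup_hom_blowup_incl //.
by rewrite mulgA.
Qed.

(** The representatives need not include 1. The trivial coset has index [i0], and [h0] corrects for
    [g i0], so that [coset_eval] sends [coset_point w] to [blowup_hom w]. *)
Let i0 := coset_index 1.
Let h0 := (g i0)^-1.

Lemma h0_mem : h0 \in H.
Proof. by rewrite -[h0]mulg1; exact: coset_indexP. Qed.

Lemma h0V_mem : h0^-1 \in H.
Proof. by rewrite gpredV h0_mem. Qed.

Lemma g_i0 : g i0 = h0^-1.
Proof. by rewrite invgK. Qed.

Definition coset_point (w : GP') : coset_space := (i0, base_incl h0 * w).

Lemma coset_act_hom v w :
  coset_act (blowup_hom v) (coset_point w) = coset_point (v * w).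
Proof.
move: v w; apply: graph_product_ind => [|v x a IHa] w.
  by rewrite blowup_hom_morph.1 coset_act1 mul1g.
rewrite blowup_hom_morph.2 coset_actM IHa -mulgA blowup_hom_incl.
move: (a * w) => {a IHa} w.
have base_point (y : G s1) i h u : h \in H -> y * g i0 = g i * h ->
    coset_act (incl y) (i0, u) = (i, base_incl h * u).
  by move=> hH yg; rewrite coset_act_incl coset_act_on_base (base_actE _ hH yg).
case: v x => [s|[i s]] x /=.
  have [ss1|ss1] := eqVneq (val s) s1.
    case: s ss1 x => s sS /= s_eq x; subst s.
    have xH := star_group_incl_mem x.
    (* Since [g i0 = h0^-1], an element [x] of [H] satisfies [x * g i0 = g i0 * (h0 * x * h0^-1)],
       and the last factor turns [h0 * w] into [h0 * x * w]. *)
    rewrite /coset_point (@base_point _ i0 (h0 * star_group_incl x * h0^-1)).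
    - congr (_, _); rewrite !mulgA -base_inclM ?gpredM ?h0_mem ?h0V_mem //.
      rewrite mulgVK base_inclM ?h0_mem //; congr (_ * _ * _).
      rewrite /base_incl star_group_inclK.
      by rewrite /base_vertex (bool_irrelevance (in_star1 _ _) sS).
    - by rewrite !gpredM ?h0_mem ?h0V_mem.
    - by rewrite g_i0 !mulgA mulVg mul1g.
  (* Now [s] is in the link of [s1]: the level stays [i0], and the copy of [x] commutes with that of
     [h0]. *)
  rewrite coset_act_incl coset_act_onE //= /coset_point /=; congr (_, _).
  rewrite blowup_incl_star star_group_inclK !mulgA; congr (_ * _).
  apply/esym/gp_inclC; case/mem_starP: (valP s) => //= s_eq.
  by move/eqP: ss1 => /(_ s_eq).
have /mem_starC[ss1 _] := valP s.
(* For an outer vertex, [g i] moves the point to [(i, w)], then [x] acts there through its copy [i],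
   and the inverse of [g i] returns to level [i0], restoring the factor [h0]. *)
rewrite 2!coset_actM (@base_point _ i h0^-1) ?h0_mem ?h0V_mem ?g_i0 //.
rewrite mulgA -base_inclM ?h0_mem ?h0V_mem // mulVg base_incl1 mul1g.
rewrite coset_act_incl coset_act_onE //= blowup_incl_out.
rewrite -gp_inclV coset_act_incl coset_act_on_base.
rewrite (@base_actE _ _ i0 h0) ?h0_mem //.
by rewrite mulVg g_i0 mulVg.
Qed.

Lemma coset_point_inj : injective coset_point.
Proof. by move=> v w [/mulgI]. Qed.

Lemma blowup_hom_inj : injective blowup_hom.
Proof.
move=> v w vw; apply: coset_point_inj.
by rewrite -[v]mulg1 -[w]mulg1 -!coset_act_hom vw.
Qed.

Lemma blowup_hom_index : has_index [set` morphism_image blowup_hom_morph] k.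
Proof.
have gpt i w : coset_act (incl (g i) * blowup_hom w) (coset_point 1) = (i, w).
  rewrite coset_actM coset_act_hom mulg1 coset_act_incl coset_act_on_base.
  rewrite (@base_actE _ _ i h0^-1) ?h0_mem ?h0V_mem ?g_i0 //.
  by rewrite mulgA -base_inclM ?h0_mem ?h0V_mem // mulVg base_incl1 mul1g.
apply: (@has_index_reps _ _ _ (fun i => incl (g i))) => [i j|a].
  (* Both sides of [g i * blowup_hom w = g j * blowup_hom 1] are applied to [coset_point 1], and the
     levels are compared. *)
  move=> /morphism_rangeP[w wE].
  have := gpt i w; rewrite wE mulVKg -[incl (g j)]mulg1 -blowup_hom_morph.1.
  by rewrite gpt => -[].
have : coset_eval (coset_act a (coset_point 1)) = a.
  rewrite coset_eval_act /coset_eval /= mulg1 blowup_hom_base ?h0_mem //.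
  by rewrite gp_inclV mulgV mulg1.
case: (coset_act a _) => i w aE; exists i; apply/morphism_rangeP; exists w.
by rewrite -aE /coset_eval mulKg.
Qed.

Lemma blowup_hom_unique :
  unique (fun psi : GP' -> GP =>
    [/\ monoid_morphism psi,
        forall (s : star Gam s1) (x : G' (inl s)),
          psi (gp_incl Gam' x) = incl (star_group_incl x)
      & forall (i : 'I_k) (s : ~` star Gam s1) (x : G (val s)),
          psi (gp_incl Gam' (x : G' (inr (i, s))))
          = (incl (g i))^-1 * incl x * incl (g i)]) blowup_hom.
Proof.
split=> [|psi [psi_morph psi_star psi_out]].
  split=> [|s x|i s x]; [exact: blowup_hom_morph | exact: blowup_hom_incl |].
  exact: blowup_hom_incl.
apply: graph_product_morph_eq => //; first exact: blowup_hom_morph.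
by case=> [s|[i s]] x; rewrite blowup_hom_incl ?psi_star ?psi_out.
Qed.

End CosetAction.

Theorem proposition6p6 (S : choiceType) (Gam : simple_graph S) (s1 : S)
    (G : S -> groupType) (H : groupClosed (G s1)) (k : nat)
    (index_H : has_index [set` H] k) :
  let GP := graph_product Gam G in
  let Gam' := blowup_graph Gam s1 k in
  let G' := blowup_group H in
  let GP' := graph_product Gam' G' in
  [/\ exists (K : groupClosed GP) (f : GP' -> subgroup K),
        [/\ has_index [set` K] k, monoid_morphism f & bijective f],
      rigid Gam -> rigid Gam'
    & forall g : 'I_k -> G s1,
        left_cosets [set` H] = range (fun i => left_coset [set` H] (g i)) ->
        exists phi : GP' -> GP,
          [/\ unique (fun psi : GP' -> GP =>
                [/\ monoid_morphism psi,
                    forall (s : star Gam s1) (x : G' (inl s)),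
                      psi (gp_incl Gam' x)
                      = gp_incl Gam (star_group_incl x)
                  & forall (i : 'I_k) (s : ~` star Gam s1) (x : G (val s)),
                      psi (gp_incl Gam' (x : G' (inr (i, s))))
                      = (gp_incl Gam (g i))^-1 * gp_incl Gam x
                        * gp_incl Gam (g i)]) phi,
              injective phi
            & has_index (range phi) k]].
Proof.
move=> GP Gam' G' GP'.
(* There are exactly [k] cosets, so a family of [k] elements that represents all of them has no
   repetition. *)
have reps (g : 'I_k -> G s1) :
    left_cosets [set` H] = range (fun i => left_coset [set` H] (g i)) ->
  (forall i j, (g i)^-1 * g j \in H -> i = j) /\
  (forall x, exists i, (g i)^-1 * x \in H).
  move=> gE; split=> [i j /left_coset_eqP|x].
    apply: (card_range_ord_inj (f := fun i => left_coset [set` H] (g i))).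
    by rewrite -gE.
  have : left_cosets [set` H] (left_coset [set` H] x) by exists x.
  by rewrite gE => -[i _ /left_coset_eqP]; exists i.
(* The first two claims name no representatives, so some are chosen from an enumeration of the
   cosets. *)
have [c _ cE] := card_eq_ord_range index_H.
have /choice[g gP] : forall i, exists x, left_coset [set` H] x = c i.
  move=> i; have : left_cosets [set` H] (c i) by rewrite -cE; exists i.
  by case=> x _ <-; exists x.
have gE : left_cosets [set` H] = range (fun i => left_coset [set` H] (g i)).
  by rewrite -cE; have /funext -> := gP.
split.
- have [g_inj g_surj] := reps g gE.
  exists (morphism_image (blowup_hom_morph Gam H g)).
  exists (morphism_corestr (blowup_hom_morph Gam H g)).
  split; [exact: blowup_hom_index | exact: morphism_corestr_morph |].
  exact/morphism_corestr_bij/blowup_hom_inj.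
- apply: rigid_blowup.
  (* The coset of 1 has an index in ['I_k], hence [0 < k]. *)
  have [_ g_surj] := reps g gE.
  by have [i _] := g_surj 1; exact: leq_ltn_trans (ltn_ord i).
- move=> {c cE gP gE} {}g /reps[g_inj g_surj].
  exists (@blowup_hom S Gam s1 G H k g); split; first exact: blowup_hom_unique.
    exact: blowup_hom_inj.
  rewrite -(morphism_image_set (blowup_hom_morph Gam H g)).
  exact: blowup_hom_index.
Qed.
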